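(* Let $A,B\in\widehat{\mathbb F_q^\times}$ with $B\neq\varepsilon$, $B^2\overline A\neq\varepsilon$ and $A\overline B\phi\neq\varepsilon$. Then for all $z\in\mathbb F_q$ with $z\neq\pm1$, $${}_2\mathbb F_1\!\left[\begin{matrix}A&B\\&B^2\end{matrix};\frac{4z}{(1+z)^2}\right]=A^2(1+z)\,{}_2\mathbb F_1\!\left[\begin{matrix}A&A\phi\overline B\\&B\phi\end{matrix};z^2\right].$$
   Context: $\mathbb F_q$ is a finite field with $q$ elements, $q$ a power of an odd prime $p$. $\widehat{\mathbb F_q^\times}$ is the group of multiplicative characters $\chi:\mathbb F_q^\times\to\mathbb C^\times$; every character, including the trivial character $\varepsilon$, is extended to $\mathbb F_q$ by $\chi(0)=0$. $\phi$ is the quadratic character, $\overline\chi$ denotes the complex-conjugate (inverse) character, and products/powers of characters are pointwise. Jacobi sum: $J(A,B)=\sum_{x\in\mathbb F_q}A(x)B(1-x)$. Period function: ${}_2\mathbb P_1\!\left[\begin{matrix}A&B\\&C\end{matrix};\lambda\right]=\sum_{y\in\mathbb F_q}B(y)\,\overline BC(1-y)\,\overline A(1-\lambda y)$; normalized function ${}_2\mathbb F_1\!\left[\begin{matrix}A&B\\&C\end{matrix};\lambda\right]=\frac{1}{J(B,C\overline B)}\,{}_2\mathbb P_1\!\left[\begin{matrix}A&B\\&C\end{matrix};\lambda\right]$. *)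

(* Defs.v *)
From HB Require Import structures.
From mathcomp Require Import all_boot all_order all_algebra all_field.
Set Implicit Arguments. Unset Strict Implicit. Unset Printing Implicit Defensive.
Import Order.TTheory GRing.Theory Num.Theory.
Local Open Scope ring_scope.

Definition mchar (F : finFieldType) (chi : F -> algC) : Prop :=
  chi 0 = 0 /\ chi 1 = 1 /\ forall x y : F, chi (x * y) = chi x * chi y.

Definition eps (F : finFieldType) : F -> algC :=
  fun x => if x == 0 then 0 else 1.

Definition qphi (F : finFieldType) : F -> algC :=
  fun x => if x == 0 then 0 else if [exists y : F, y ^+ 2 == x] then 1 else -1.

(* pointwise product and complex conjugate (= inverse) of characters *)
Definition cmul (F : finFieldType) (chi psi : F -> algC) : F -> algC :=
  fun x => chi x * psi x.
Definition cconj (F : finFieldType) (chi : F -> algC) : F -> algC :=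
  fun x => (chi x)^*.

Definition Jacobi (F : finFieldType) (A B : F -> algC) : algC :=
  \sum_(x : F) A x * B (1 - x).

Definition P21 (F : finFieldType) (A B C : F -> algC) (lam : F) : algC :=
  \sum_(y : F) B y * cmul (cconj B) C (1 - y) * cconj A (1 - lam * y).

Definition F21 (F : finFieldType) (A B C : F -> algC) (lam : F) : algC :=
  P21 A B C lam / Jacobi B (cmul C (cconj B)).

(* Main.v *)
(** Put C = B phi, X = A phi B^-1, Y = A B^-2 (so X = Y C and A = C X) and
    w = z^2.  With x = 1 - 2 y the left-hand period is, up to a factor,
    G(z) = \sum_x B(1 - x^2) A^-1(1 + 2xz + w), and x |-> r = -(1 + 2xz + w)
    turns this into \sum_r A^-1(r) B(D(r)), where D(r) = (1 + w + r)^2 - 4w.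
    On the right, v = (1 - y) / (1 - w y) yields
    \sum_v C(v) X((1 - v) (1 - w v) / v).  Writing X = Y C as the additive
    convolution of Y and C (up to a Jacobi sum), the sum over v becomes
    \sum_v C(w v^2 - (1 + w + r) v + 1), a character sum of a quadratic
    polynomial, which is a constant plus a multiple of B(D(r)); finally
    r |-> (1 - w)^2 / r exchanges Y and A^-1.  Hence the two periods are
    proportional, also at z = 0, where the normalising Jacobi sums live. *)

Require Import Defs.
From HB Require Import structures.
From mathcomp Require Import all_boot all_order all_algebra all_field.
From mathcomp Require Import ring.
From Stdlib Require Import FunctionalExtensionality.
Import Order.TTheory GRing.Theory Num.Theory.
Local Open Scope ring_scope.

(** * Elementary properties of multiplicative characters *)

Section Characters.
Variable F : finFieldType.
Implicit Types chi psi : F -> algC.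

Lemma mchar0 chi : mchar chi -> chi 0 = 0.
Proof. by case. Qed.

Lemma mchar1 chi : mchar chi -> chi 1 = 1.
Proof. by case=> _ []. Qed.

Lemma mcharM chi : mchar chi -> {morph chi : x y / x * y}.
Proof. by case=> _ []. Qed.

Lemma mchar_neq0 chi x : mchar chi -> x != 0 -> chi x != 0.
Proof.
move=> hc x0; apply/eqP => cx0.
have := mchar1 _ hc; rewrite -(divff x0) mcharM // cx0 mul0r => /eqP.
by rewrite eq_sym oner_eq0.
Qed.

Lemma mcharV chi x : mchar chi -> chi x^-1 = (chi x)^-1.
Proof.
move=> hc; have [->|x0] := eqVneq x 0; first by rewrite invr0 mchar0 // invr0.
apply: (mulfI (mchar_neq0 _ x hc x0)).
by rewrite -mcharM // !divff ?mchar1 // mchar_neq0.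
Qed.

Lemma mcharX chi n x : mchar chi -> chi (x ^+ n) = chi x ^+ n.
Proof.
move=> hc; elim: n => [|n IHn]; first by rewrite !expr0 mchar1.
by rewrite !exprS mcharM // IHn.
Qed.

Lemma mcharN1_sqr chi : mchar chi -> chi (-1) ^+ 2 = 1.
Proof. by move=> hc; rewrite -mcharX // sqrrN expr1n mchar1. Qed.

Lemma mcharN chi x : mchar chi -> chi (- x) = chi (-1) * chi x.
Proof. by move=> hc; rewrite -mcharM // mulN1r. Qed.

(** Values of [chi] at nonzero [x] have modulus 1, because x^(q-1) = 1; at 0 both sides vanish by
    the convention [0^-1 = 0]. *)
Lemma cconjE chi x : mchar chi -> cconj chi x = (chi x)^-1.
Proof.
move=> hc; rewrite /cconj; have [->|x0] := eqVneq x 0.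
  by rewrite mchar0 // conjC0 invr0.
have q0 : (0 < #|F|)%N by rewrite ltnW // finNzRing_gt1.
have q1 : (0 < #|F|.-1)%N by rewrite -ltnS prednK // finNzRing_gt1.
have nx1 : `|chi x| = 1.
  apply/eqP; rewrite -(pexpr_eq1 q1) // -normrX -mcharX //.
  have -> : x ^+ #|F|.-1 = 1.
    by apply: (mulfI x0); rewrite -exprS prednK ?expf_card ?mulr1.
  by rewrite mchar1 // normr1.
apply: (mulfI (mchar_neq0 _ x hc x0)).
by rewrite -normCK nx1 expr1n divff // mchar_neq0.
Qed.

Lemma mchar_cmul chi psi : mchar chi -> mchar psi -> mchar (cmul chi psi).
Proof.
move=> hc hp; rewrite /cmul; split; first by rewrite mchar0 // mul0r.
split; first by rewrite !mchar1 // mulr1.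
by move=> x y; rewrite !mcharM // mulrACA.
Qed.

Lemma mchar_cconj chi : mchar chi -> mchar (cconj chi).
Proof.
move=> hc; split; first by rewrite /cconj mchar0 // conjC0.
split; first by rewrite /cconj mchar1 // conjC1.
by move=> x y; rewrite /cconj mcharM // rmorphM.
Qed.

Lemma mchar_neq_epsP chi : mchar chi -> chi <> @eps F ->
  exists2 a, a != 0 & chi a != 1.
Proof.
move=> hc ne.
have [/existsP[a /andP[]]|/existsPn h] := boolP [exists a, (a != 0) && (chi a != 1)].
  by exists a.
case: ne; apply: functional_extensionality => x; rewrite /eps.
case: eqVneq => [->|x0]; first by rewrite mchar0.
by move: (h x); rewrite x0 /= negbK => /eqP.
Qed.

Lemma mchar_neq_eps chi a : a != 0 -> chi a != 1 -> chi <> @eps F.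
Proof. by move=> a0 ca e; move: ca; rewrite e /eps (negPf a0) eqxx. Qed.

(** * Changes of variable and orthogonality in character sums *)

Lemma sum_mulf (f : F -> algC) a : a != 0 -> \sum_x f (a * x) = \sum_x f x.
Proof. by move=> a0; rewrite [RHS](reindex_inj (mulfI a0)). Qed.

Lemma sum_sub_rev (f : F -> algC) a : \sum_x f (a - x) = \sum_x f x.
Proof. by rewrite [RHS](reindex_inj (inj_comp (addrI a) oppr_inj)). Qed.

Lemma sum_subr (f : F -> algC) a : \sum_x f (x - a) = \sum_x f x.
Proof. by rewrite [RHS](reindex_inj (addIr (- a))). Qed.

(** Scaling the variable by some [a] with [chi a != 1] multiplies the sum by [chi a] yet leaves it
    unchanged. *)
Lemma sum_mchar0 chi : mchar chi -> chi <> @eps F -> \sum_x chi x = 0.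
Proof.
move=> hc /(mchar_neq_epsP _ hc)[a a0 ca].
apply/eqP; move: (sum_mulf chi a a0) => /eqP.
under eq_bigr do rewrite mcharM //.
rewrite -mulr_sumr -subr_eq0 -{2}[\sum_x _]mul1r -mulrBl mulf_eq0 subr_eq0.
by rewrite (negPf ca).
Qed.

(** The difference is q for nontrivial [chi] and 1 for the trivial one. Both cases occur, since B
    phi may be trivial; this keeps the normalising sums nonzero. *)
Lemma sum_mchar_neq_card chi : mchar chi -> #|F|%:R - \sum_x chi x != 0.
Proof.
move=> hc; have [/existsP[a /andP[a0 ca]]|/existsPn h] :=
  boolP [exists a, (a != 0) && (chi a != 1)].
  rewrite (sum_mchar0 _ hc (mchar_neq_eps _ a a0 ca)) subr0 pnatr_eq0.
  by rewrite -lt0n ltnW // finNzRing_gt1.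
have e x : x != 0 -> chi x = 1.
  by move=> x0; move: (h x); rewrite x0 /= negbK => /eqP.
rewrite (bigD1 0) //= mchar0 // add0r (eq_bigr (fun=> 1)); last by move=> x /e.
have -> : #|F|%:R = \sum_(x : F) (1 : algC) by rewrite sumr_const.
by rewrite (bigD1 0) //= addrK oner_neq0.
Qed.

(** * The quadratic character in odd characteristic *)

Section Quadratic.
Hypothesis char_neq2 : (2%:R : F) != 0.

(** Each [t] has 1 + phi(t) square roots: one at 0, two or none elsewhere. *)
Lemma sum_sqr (f : F -> algC) : \sum_y f (y ^+ 2) = \sum_t (1 + qphi t) * f t.
Proof.
rewrite (partition_big (fun y => y ^+ 2) predT) //=.
apply: eq_bigr => t _; rewrite /qphi; case: eqVneq => [->|t0].
  rewrite (big_pred1 0) ?expr0n /= ?addr0 ?mul1r // => y.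
  by rewrite /= expf_eq0.
case: ifP => [/existsP[s /eqP st]|/existsPn ne].
  have s0 : s != 0 by apply: contraNneq t0 => s0; rewrite -st s0 expr0n.
  have sNs : s != - s.
    by rewrite -addr_eq0 -mulr2n -mulr_natr mulf_neq0.
  rewrite (bigD1 s) /= ?st // (bigD1 (- s)) /=; last by rewrite sqrrN st eqxx eq_sym.
  rewrite sqrrN st big1 ?addr0 ?mulrDl ?mul1r // => y /andP[/andP[]].
  by rewrite -st eqf_sqr => /orP[]/eqP->; rewrite eqxx.
by rewrite subrr mul0r big_pred0 // => y; apply: negbTE (ne y).
Qed.

Lemma qphi_neq0 (t : F) : t != 0 -> (qphi t == 1) || (qphi t == -1).
Proof. by rewrite /qphi => /negPf->; case: ifP; rewrite eqxx ?orbT. Qed.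

Lemma sum_qphi : \sum_(t : F) qphi t = 0.
Proof.
have := sum_sqr (fun=> 1); under [RHS]eq_bigr do rewrite mulr1.
by rewrite big_split /= => /eqP; rewrite addrC -subr_eq subrr eq_sym => /eqP.
Qed.

Lemma qphi_sqrM (s t : F) : s != 0 -> qphi (s ^+ 2 * t) = qphi t.
Proof.
move=> s0; rewrite /qphi mulf_eq0 expf_eq0 (negPf s0) /=.
case: eqP => // _; congr (if _ then _ else _).
apply/existsP/existsP => -[y /eqP e].
  by exists (y / s); rewrite expr_div_n e mulrC mulKf // expf_neq0.
by exists (s * y); rewrite exprMn e.
Qed.

(* For a nonsquare x, every term of the vanishing sum of phi(t) + phi(x t) is
   nonpositive, hence zero. *)
Lemma mchar_qphi : mchar (@qphi F).
Proof.
have q1 : qphi (1 : F) = 1.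
  rewrite /qphi oner_eq0; case: ifP => // /existsPn/(_ 1).
  by rewrite expr1n eqxx.
split; first by rewrite /qphi eqxx.
split=> // x y; have [->|x0] := eqVneq x 0; first by rewrite /qphi !mul0r eqxx mul0r.
have sq (t : F) : t != 0 -> qphi t != -1 -> exists2 s, s != 0 & t = s ^+ 2.
  rewrite /qphi => t0; rewrite (negPf t0); case: ifP; rewrite ?eqxx // => /existsP[s /eqP st] _.
  by exists s; rewrite ?st //; apply: contraNneq t0 => s0; rewrite -st s0 expr0n.
have [ex|] := eqVneq (qphi x) (-1); last first.
  case/(sq _ x0) => s s0 ->; rewrite qphi_sqrM //.
  by have := qphi_sqrM s 1 s0; rewrite mulr1 q1 => ->; rewrite mul1r.
rewrite ex mulN1r; apply/eqP; rewrite -addr_eq0.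
have sum0 : \sum_t - (qphi (x * t) + qphi t) = 0.
  by rewrite sumrN big_split /= (sum_mulf (@qphi F)) // sum_qphi addr0 oppr0.
rewrite -oppr_eq0; apply/eqP.
apply: (psumr_eq0P (P := predT) (F := fun t => - (qphi (x * t) + qphi t)) _ sum0) => // t _.
have [->|t0] := eqVneq t 0; first by rewrite mulr0 /qphi eqxx addr0 oppr0.
have [et|] := eqVneq (qphi t) (-1); last first.
  case/(sq _ t0) => s s0 ->; rewrite [x * _]mulrC qphi_sqrM // ex.
  by have := qphi_sqrM s 1 s0; rewrite mulr1 q1 => ->; rewrite addNr oppr0.
rewrite et opprB; have /orP[] := qphi_neq0 _ (mulf_neq0 x0 t0) => /eqP-> //.
  by rewrite subrr.
by rewrite opprK addr_ge0.
Qed.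
Lemma qphiK (x : F) : x != 0 -> qphi x * qphi x = 1.
Proof. by case/qphi_neq0/orP => /eqP->; rewrite ?mulrNN mulr1. Qed.

Lemma qphi_neq_eps : @qphi F <> @eps F.
Proof.
move=> e; have := sum_qphi; rewrite e (bigD1 0) //= /eps eqxx add0r.
rewrite (eq_bigr (fun=> 1)); last by move=> x /negPf->.
rewrite (bigD1 1) ?oner_eq0 //= => /eqP; rewrite gt_eqF // ltr_pwDl //.
by apply: sumr_ge0.
Qed.

(** * Jacobi sums as convolutions, and their products *)

Lemma cmulC chi psi : cmul chi psi = cmul psi chi.
Proof. by apply: functional_extensionality => x; rewrite /cmul mulrC. Qed.

(** For nonzero [s], scale r by [s]. At [s = 0] the left side is a multiple of the sum of the
    nontrivial product character, hence 0. *)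
Lemma sum_mchar_conv chi psi s : mchar chi -> mchar psi -> cmul chi psi <> @eps F ->
  \sum_r chi r * psi (s - r) = cmul chi psi s * Jacobi chi psi.
Proof.
move=> hc hp ne; have hcp := mchar_cmul _ _ hc hp.
have [->|s0] := eqVneq s 0.
  rewrite (mchar0 _ hcp) mul0r.
  under eq_bigr do rewrite sub0r (mcharN _ _ hp) mulrCA.
  by rewrite -mulr_sumr (sum_mchar0 _ hcp ne) mulr0.
rewrite -(sum_mulf (fun r => chi r * psi (s - r)) s s0) mulr_sumr.
apply: eq_bigr => r _; rewrite -{2}[s]mulr1 -mulrBr (mcharM _ hc) (mcharM _ hp).
by rewrite /cmul mulrACA.
Qed.

(** For nonzero [c], c/s - 1 takes every value but -1 once as s runs over nonzero elements, so the
    full sum 0 loses chi(-1). For [c = 0] all q - 1 terms equal chi(-1). *)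
Lemma sum_mchar_moebius chi c : mchar chi -> chi <> @eps F ->
  \sum_s chi ((c - s) / s) = chi (-1) * (#|F|%:R * (c == 0)%:R - 1).
Proof.
move=> hc ne; rewrite (bigD1 0) //= invr0 mulr0 (mchar0 _ hc) add0r.
have [->|c0] := eqVneq c 0.
  have -> : #|F|%:R = \sum_(s : F) (1 : algC) by rewrite sumr_const.
  rewrite mulr1 [X in X - 1](bigD1 0) //= addrAC subrr add0r mulr_sumr.
  by apply: eq_bigr => s s0; rewrite sub0r mulNr divff // mulr1.
rewrite mulr0 sub0r mulrN1.
rewrite (reindex_onto (fun s => c / s) (fun s => c / s)) /=; last first.
  by move=> s s0; rewrite invf_div mulrC divfK.
have := sum_mchar0 _ hc ne; rewrite -(sum_subr chi 1) (bigD1 0) //= sub0r.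
move/eqP; rewrite addrC addr_eq0 => /eqP <-.
apply: eq_big => s; last first.
  move=> /andP[h _]; congr chi; field.
  by rewrite c0 ?andbT /=; apply: contraNneq h => ->; rewrite invr0 mulr0.
have [->|s0] := eqVneq s 0; first by rewrite invr0 mulr0 eqxx.
by rewrite mulf_neq0 ?invr_eq0 // invf_div mulrC divfK // eqxx.
Qed.

(** Writing the first factor as a convolution gives a double sum whose inner sum is the Moebius sum
    with c = 1 - t, and this singles out t = 1. Keeping the sum of [psi] lets the formula cover
    trivial [psi]. *)
Lemma Jacobi_prod chi psi : mchar chi -> mchar psi ->
  chi <> @eps F -> cmul chi psi <> @eps F ->
  Jacobi chi psi * Jacobi (cmul chi psi) (cconj chi)
    = chi (-1) * (#|F|%:R - \sum_x psi x).
Proof.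
move=> hc hp ne ne2; rewrite [Jacobi (cmul _ _) _]/Jacobi mulr_sumr.
have -> : \sum_s Jacobi chi psi * (cmul chi psi s * cconj chi (1 - s))
        = \sum_s \sum_t psi t * chi ((s - t) / (1 - s)).
  apply: eq_bigr => s _; rewrite mulrA [Jacobi _ _ * _]mulrC -sum_mchar_conv //.
  rewrite -(sum_sub_rev (fun r => chi r * psi (s - r)) s) mulr_suml.
  apply: eq_bigr => t _; rewrite subKr (cconjE _ _ hc) (mcharM _ hc) (mcharV _ _ hc).
  by rewrite mulrAC mulrC.
rewrite exchange_big /=.
have inner t : \sum_s psi t * chi ((s - t) / (1 - s))
     = psi t * (chi (-1) * (#|F|%:R * (t == 1)%:R - 1)).
  rewrite -mulr_sumr; congr (_ * _).
  rewrite -(sum_sub_rev (fun s => chi ((s - t) / (1 - s))) 1).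
  rewrite -subr_eq0 -opprB oppr_eq0 -(sum_mchar_moebius chi (1 - t)) //.
  by apply: eq_bigr => s _; rewrite subKr addrAC.
rewrite (eq_bigr _ (fun t _ => inner t)) (bigD1 1) //= [\sum_x psi x](bigD1 1) //= eqxx.
rewrite (mchar1 _ hp) (eq_bigr (fun t => - chi (-1) * psi t)); last first.
  by move=> t /negPf->; rewrite mulr0 sub0r; ring.
by rewrite -mulr_sumr mulr1; ring.
Qed.

(** * Sums over quadratic polynomials, and the right-hand period *)

Lemma sum_mchar_quadratic chi z b : z != 0 -> mchar chi ->
  cmul chi (@qphi F) <> @eps F ->
  \sum_y chi (z ^+ 2 * y ^+ 2 - b * y + 1) = \sum_y chi y
    + chi (-1) * Jacobi (@qphi F) chi
      * cmul chi (@qphi F) ((b ^+ 2 - 4 * z ^+ 2) / (4 * z ^+ 2)).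
Proof.
move=> z0 hc ne; set d := (_ / _).
have four0 : (4 : F) != 0 by rewrite (natrM _ 2 2) mulf_neq0.
(* Completing the square: [d] is the discriminant divided by 4z^2. *)
have -> : \sum_y chi (z ^+ 2 * y ^+ 2 - b * y + 1)
        = \sum_y chi ((z * y - b / (2 * z)) ^+ 2 - d).
  by apply: eq_bigr => y _; congr chi; rewrite /d; field; rewrite ?z0 ?four0 ?char_neq2.
rewrite (sum_mulf (fun y => chi ((y - b / (2 * z)) ^+ 2 - d)) z z0).
rewrite (sum_subr (fun y => chi (y ^+ 2 - d))) (sum_sqr (fun t => chi (t - d))).
(* In the weight 1 + phi(t), the 1 gives the constant term and phi gives a convolution with
   [chi]. *)
under eq_bigr do rewrite mulrDl mul1r.
rewrite big_split /= (sum_subr chi); congr (_ + _).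
rewrite -mulrA [Jacobi _ _ * _]mulrC cmulC -sum_mchar_conv //; last by rewrite cmulC.
  rewrite mulr_sumr; apply: eq_bigr => t _.
  by rewrite -opprB (mcharN _ _ hc) mulrCA.
exact: mchar_qphi.
Qed.

(** The map [h] is an involution away from its pole [w^-1], where the summands of both sides
    vanish. *)
Lemma P21_sum_moebius X C (w : F) : mchar X -> mchar C -> w != 0 -> w != 1 ->
  \sum_y X y * (C (1 - y) / X (1 - y)) / (C (1 - w * y) * X (1 - w * y))
    = (X (1 - w)) ^- 2 * \sum_v C v * X ((1 - v) * (1 - w * v) / v).
Proof.
move=> hX hC w0 w1; pose h (v : F) := (1 - v) / (1 - w * v).
have w1' : 1 - w != 0 by rewrite subr_eq0 eq_sym.
have den v : v != w^-1 -> 1 - w * v != 0.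
  by move=> vw; apply: contraNneq vw => e; rewrite -(inj_eq (mulfI w0)) divff // eq_sym -subr_eq0 e.
have hE v : v != w^-1 -> 1 - w * h v = (1 - w) / (1 - w * v).
  by move=> /den d; rewrite /h; field.
have h_neq v : v != w^-1 -> h v != w^-1.
  move=> vw; have := hE v vw; apply: contra_eq_neq => ->; rewrite divff // subrr eq_sym.
  by rewrite mulf_neq0 // invr_neq0 // den.
have hK v : v != w^-1 -> h (h v) = v.
  move=> vw; rewrite {1}/h hE // /h; have := den v vw => d; field.
  by rewrite d w1'.
(* Division by zero gives h(w^-1) = 0 and h(0) = 1, so the pole fails the reindexing condition
   [h (h v) == v]. *)
have h_pole : h (h w^-1) != w^-1.
  by rewrite /h divff // subrr invr0 !mulr0 !subr0 divr1 eq_sym invr_eq1.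
rewrite (bigD1 w^-1) //= divff // subrr (mchar0 _ hC) mul0r invr0 mulr0 add0r.
rewrite [\sum_v _](bigD1 w^-1) //= divff // subrr mulr0 mul0r (mchar0 _ hX) mulr0 add0r.
rewrite (reindex_onto h h) /=; last by move=> v; exact: hK.
rewrite mulr_sumr; apply: eq_big => v.
  have [->|vw] := eqVneq v w^-1; last by rewrite h_neq // hK // eqxx.
  by rewrite (negPf h_pole) andbF.
move=> /andP[hv hhv].
have vw : v != w^-1.
  by apply: contraTneq hhv => ->.
have d := den v vw; rewrite (hE v vw).
have -> : 1 - h v = v * (1 - w) / (1 - w * v) by rewrite /h; field.
rewrite /h !(mcharM _ hX, mcharM _ hC, mcharV _ _ hX, mcharV _ _ hC).
have [->|v0] := eqVneq v 0; first by rewrite (mchar0 _ hC) !(mul0r, mulr0).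
by field; rewrite !mchar_neq0.
Qed.

(** With s = (1-v)(1-wv)/v, multiplying the convolution of Y(r) and C(s - r) by C(v) puts the
    quadratic v(s - r) inside [C]. *)
Lemma Jacobi_mul_sum_quadratic Y C (w : F) : mchar Y -> mchar C ->
  Y <> @eps F -> cmul Y C <> @eps F ->
  Jacobi Y C * \sum_v C v * cmul Y C ((1 - v) * (1 - w * v) / v)
    = \sum_r Y r * \sum_v C (w * v ^+ 2 - (1 + w + r) * v + 1).
Proof.
move=> hY hC neY neYC; rewrite mulr_sumr.
under eq_bigr => v _.
  rewrite mulrCA [Jacobi _ _ * _]mulrC -sum_mchar_conv // mulr_sumr.
  under eq_bigr do rewrite mulrCA.
  over.
rewrite exchange_big /=.
(* At v = 0 the left term is 0 while the polynomial is 1; the resulting [- Y r] sums to 0 over r. *)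
have e r : \sum_v Y r * (C v * C ((1 - v) * (1 - w * v) / v - r))
   = Y r * (\sum_v C (w * v ^+ 2 - (1 + w + r) * v + 1)) - Y r.
  rewrite -mulr_sumr -[X in _ = _ - X]mulr1 -mulrBr; congr (_ * _).
  rewrite (bigD1 0) //= (mchar0 _ hC) mul0r add0r [X in _ = X - _](bigD1 0) //=.
  rewrite expr0n /= !mulr0 subr0 add0r (mchar1 _ hC) addrAC subrr add0r.
  apply: eq_bigr => v v0; rewrite -(mcharM _ hC); congr C; field; exact: v0.
by rewrite (eq_bigr _ (fun r _ => e r)) sumrB (sum_mchar0 _ hY neY) subr0.
Qed.

(** The substitution r -> c^2/r reproduces the quadratic up to the factor c^2/r^2. It thereby trades
    [Y] for the inverse of Y B^2. *)
Lemma sum_mchar_reciprocal Y B (c e f : F) : mchar Y -> mchar B -> c != 0 ->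
  \sum_r Y r * B ((r ^+ 2 + e * r + c ^+ 2) / f)
    = (Y c * B c) ^+ 2 *
      \sum_r B ((r ^+ 2 + e * r + c ^+ 2) / f) / (Y r * B r ^+ 2).
Proof.
move=> hY hB c0; have c2 : c ^+ 2 != 0 by rewrite expf_neq0.
rewrite (reindex_inj (inj_comp (mulfI c2) invr_inj)) /= mulr_sumr.
apply: eq_bigr => r _; have [->|r0] := eqVneq r 0.
  by rewrite invr0 mulr0 (mchar0 _ hY) !mul0r invr0 !mulr0.
have -> : (c ^+ 2 / r) ^+ 2 + e * (c ^+ 2 / r) + c ^+ 2
        = c ^+ 2 / r ^+ 2 * (r ^+ 2 + e * r + c ^+ 2) by field.
rewrite !(mcharM _ hY, mcharM _ hB, mcharV _ _ hY, mcharV _ _ hB, mcharX _ _ _ hY, mcharX _ _ _ hB).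
have [-> | f0] := eqVneq f 0; first by rewrite (mchar0 _ hB) invr0 !(mulr0, mul0r).
by field; rewrite !mchar_neq0.
Qed.

(** * The left-hand period as a finite-field Gegenbauer integral *)

Definition gegenbauer_sum A B (z : F) : algC :=
  \sum_x B (1 - x ^+ 2) / A (1 + 2 * x * z + z ^+ 2).

(** With r = -(1 + z^2) - 2zx the quadratic in r becomes 4z^2(x^2 - 1). *)
Lemma gegenbauer_sumE A B z : mchar A -> mchar B -> z != 0 ->
  gegenbauer_sum A B z = A (-1) * B (-1) *
    \sum_r B ((r ^+ 2 + 2 * (1 + z ^+ 2) * r + (1 - z ^+ 2) ^+ 2) / (4 * z ^+ 2)) / A r.
Proof.
move=> hA hB z0; have z2 : 2 * z != 0 by rewrite mulf_neq0.
have four0 : (4 : F) != 0 by rewrite (natrM _ 2 2) mulf_neq0.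
pose f r := B ((r ^+ 2 + 2 * (1 + z ^+ 2) * r + (1 - z ^+ 2) ^+ 2) / (4 * z ^+ 2)) / A r.
rewrite -/(\sum_r f r) -(sum_sub_rev f (- (1 + z ^+ 2))).
rewrite -(sum_mulf (fun r => f (- (1 + z ^+ 2) - r)) (2 * z) z2) mulr_sumr.
apply: eq_bigr => x _; rewrite /f.
set u := _ / (4 * _); have -> : u = - (1 - x ^+ 2) by rewrite /u; field; rewrite z0 four0.
have -> : - (1 + z ^+ 2) - 2 * z * x = - (1 + 2 * x * z + z ^+ 2) by ring.
rewrite (mcharN _ (1 - _) hB) (mcharN _ (_ + _) hA) invfM.
have a0 : A (-1) != 0 by rewrite mchar_neq0 // oppr_eq0 oner_eq0.
set v := (A (1 + _ + _))^-1.
rewrite [RHS](_ : _ = B (-1) ^+ 2 * (B (1 - x ^+ 2) * v)); last by field.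
by rewrite (mcharN1_sqr _ hB) mul1r.
Qed.

Lemma gegenbauer_sum0 A B : mchar A -> mchar B -> B <> @eps F ->
  gegenbauer_sum A B 0 = Jacobi (@qphi F) B.
Proof.
move=> hA hB neB; rewrite /gegenbauer_sum.
under eq_bigr do rewrite mulr0 addr0 expr0n /= addr0 (mchar1 _ hA) divr1.
rewrite (sum_sqr (fun t => B (1 - t))).
under eq_bigr do rewrite mulrDl mul1r.
by rewrite big_split /= (sum_sub_rev B) (sum_mchar0 _ hB neB) add0r.
Qed.

(** Put x = 1 - 2y: then 1 - x^2 = 4y(1-y), whence the factor [B 4], and (1+z)^2 - 4zy = 1 + 2xz +
    z^2. *)
Lemma P21_gegenbauer A B z : mchar A -> mchar B -> 1 + z != 0 ->
  P21 A B (cmul B B) (4 * z / (1 + z) ^+ 2)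
    = A (1 + z) ^+ 2 / B 4 * gegenbauer_sum A B z.
Proof.
move=> hA hB z1.
have four0 : (4 : F) != 0 by rewrite (natrM _ 2 2) mulf_neq0.
rewrite /gegenbauer_sum -(sum_sub_rev _ 1) -(sum_mulf _ 2 char_neq2) mulr_sumr.
apply: eq_bigr => y _; rewrite /cmul !cconjE //.
have -> : 1 - 4 * z / (1 + z) ^+ 2 * y
        = (1 + 2 * (1 - 2 * y) * z + z ^+ 2) / (1 + z) ^+ 2 by field.
have -> : 1 - (1 - 2 * y) ^+ 2 = 4 * (y * (1 - y)) by ring.
rewrite !(mcharM _ hB) (mcharM _ hA) (mcharV _ _ hA) (mcharX _ _ _ hA) invfM invrK.
have -> : (B (1 - y))^-1 * (B (1 - y) * B (1 - y)) = B (1 - y).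
  have [->|y1] := eqVneq (1 - y) 0; first by rewrite (mchar0 _ hB) !mulr0.
  by rewrite mulKf // mchar_neq0.
by set v := (A _)^-1; field; rewrite mchar_neq0.
Qed.

(** Each normalised function thus becomes the quotient of a period by its value at argument 0. *)
Lemma Jacobi_P21 (A B C : F -> algC) : mchar A -> Jacobi B (cmul C (cconj B)) = P21 A B C 0.
Proof.
move=> hA; apply: eq_bigr => x _.
by rewrite mul0r subr0 /cconj (mchar1 _ hA) conjC1 mulr1 /cmul [C _ * _]mulrC.
Qed.

Lemma JacobiC chi psi : Jacobi chi psi = Jacobi psi chi.
Proof.
rewrite /Jacobi -(sum_sub_rev _ 1); apply: eq_bigr => x _.
by rewrite subKr mulrC.
Qed.

(** * Proportionality of the two periods, with a constant independent of z *)

Section Transformation.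
Variables A B : F -> algC.
Hypotheses (hA : mchar A) (hB : mchar B) (B_neq : B <> @eps F).
Let C := cmul B (@qphi F).
Let X := cmul (cmul A (@qphi F)) (cconj B).
Let Y := cmul A (cconj (cmul B B)).
Hypotheses (X_neq : X <> @eps F) (Y_neq : Y <> @eps F).

Let hphi := mchar_qphi.
Let hC : mchar C := mchar_cmul _ _ hB hphi.
Let hX : mchar X := mchar_cmul _ _ (mchar_cmul _ _ hA hphi) (mchar_cconj _ hB).
Let hY : mchar Y := mchar_cmul _ _ hA (mchar_cconj _ (mchar_cmul _ _ hB hB)).

Let YE x : Y x = A x / (B x * B x).
Proof. by rewrite /Y /cmul (cconjE _ _ (mchar_cmul _ _ hB hB)). Qed.

Let XE x : X x = A x * qphi x / B x.
Proof. by rewrite /X /cmul cconjE. Qed.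

Let XYC : X = cmul Y C.
Proof.
apply: functional_extensionality => x; rewrite /cmul XE YE /C /cmul.
have [->|x0] := eqVneq x 0; first by rewrite (mchar0 _ hA) !mul0r.
by field; rewrite mchar_neq0.
Qed.

Let ACX x : A x = C x * X x.
Proof.
rewrite XE /C /cmul; have [->|x0] := eqVneq x 0; first by rewrite (mchar0 _ hA) !(mul0r,mulr0).
transitivity (A x * (qphi x * qphi x)); first by rewrite qphiK // mulr1.
by field; rewrite mchar_neq0.
Qed.

Let BCphi : cmul C (@qphi F) = B.
Proof.
apply: functional_extensionality => x; rewrite /C /cmul -mulrA.
have [->|x0] := eqVneq x 0; first by rewrite (mchar0 _ hB) mul0r.
by rewrite qphiK // mulr1.
Qed.

Let Y_inv : cmul C (cconj X) = cconj Y.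
Proof.
apply: functional_extensionality => x; rewrite XYC /cmul.
rewrite (cconjE _ _ (mchar_cmul _ _ hY hC)) (cconjE _ _ hY) /cmul invfM.
have [->|x0] := eqVneq x 0; first by rewrite (mchar0 _ hC) (mchar0 _ hY) invr0 !mul0r.
by rewrite mulrCA divff ?mulr1 // mchar_neq0.
Qed.

Let phi_inv : cconj (@qphi F) = @qphi F.
Proof.
apply: functional_extensionality => x; rewrite (cconjE _ _ hphi).
have [->|x0] := eqVneq x 0; first by rewrite (mchar0 _ hphi) invr0.
by case/orP: (qphi_neq0 _ x0) => /eqP->; rewrite ?invrN invr1.
Qed.

Let N1_neq0 : (-1 : F) != 0.
Proof. by rewrite oppr_eq0 oner_eq0. Qed.

(** This is the product formula for [Y] and [C], as X = YC and C X^-1 = Y^-1. The right side is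
    nonzero, hence so is the normaliser. *)
Lemma Jacobi_P21_0 :
  Jacobi Y C * P21 A X C 0 = A (-1) * (#|F|%:R - \sum_x C x).
Proof.
rewrite -Jacobi_P21 // Y_inv {1}XYC Jacobi_prod //; last by rewrite -XYC.
by rewrite YE -expr2 (mcharN1_sqr _ hB) divr1.
Qed.

(** Since B = C phi, the value at 0 is the Jacobi sum of phi and C phi, and the product formula for
    phi and [C] applies. *)
Lemma Jacobi_gegenbauer_0 :
  Jacobi (@qphi F) C * gegenbauer_sum A B 0 = qphi (-1 : F) * (#|F|%:R - \sum_x C x).
Proof.
rewrite gegenbauer_sum0 // -(Jacobi_prod _ _ hphi hC).
- by rewrite cmulC BCphi phi_inv [Jacobi B _]JacobiC.
- exact: qphi_neq_eps.
- by rewrite cmulC BCphi.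
Qed.

Lemma P21_gegenbauer_proportional z : z ^+ 2 != 1 ->
  Jacobi Y C * P21 A X C (z ^+ 2)
    = Jacobi (@qphi F) C * qphi (-1 : F) * A (-1) * gegenbauer_sum A B z.
Proof.
move=> z1; have [->|z0] := eqVneq z 0.
  (* The substitutions below divide by z; at [z = 0] both sides are instead evaluated by the product
     formula and compared through phi(-1)^2 = 1. *)
  rewrite expr0n /= Jacobi_P21_0 -!mulrA [A _ * gegenbauer_sum _ _ _]mulrC.
  rewrite [Jacobi _ _ * _]mulrCA [Jacobi _ _ * _]mulrA Jacobi_gegenbauer_0.
  by rewrite !mulrA qphiK // mul1r mulrC.
have w0 : z ^+ 2 != 0 by rewrite expf_neq0.
have c0 : 1 - z ^+ 2 != 0 by rewrite subr_eq0 eq_sym.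
have -> : P21 A X C (z ^+ 2) = \sum_y X y * (C (1 - y) / X (1 - y))
      / (C (1 - z ^+ 2 * y) * X (1 - z ^+ 2 * y)).
  apply: eq_bigr => y _; rewrite (cconjE _ _ hA) /cmul (cconjE _ _ hX) ACX.
  by rewrite [_^-1 * C _]mulrC.
rewrite P21_sum_moebius // mulrCA {2}XYC Jacobi_mul_sum_quadratic //; last by rewrite -XYC.
have neC : cmul C (@qphi F) <> @eps F by rewrite BCphi.
under eq_bigr => r _ do rewrite (sum_mchar_quadratic _ _ _ z0 hC neC) mulrDr BCphi mulrCA.
(* The constant term of the quadratic sum does not depend on [r], so it disappears against the
   vanishing sum of [Y]. *)
rewrite big_split /= -mulr_suml (sum_mchar0 _ hY Y_neq) mul0r add0r -mulr_sumr.
have -> : \sum_r Y r * B (((1 + z ^+ 2 + r) ^+ 2 - 4 * z ^+ 2) / (4 * z ^+ 2))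
   = \sum_r Y r * B ((r ^+ 2 + 2 * (1 + z ^+ 2) * r + (1 - z ^+ 2) ^+ 2) / (4 * z ^+ 2)).
  by apply: eq_bigr => r _; congr (_ * B (_ / _)); ring.
rewrite sum_mchar_reciprocal // gegenbauer_sumE //.
under eq_bigr => r _.
  have -> : Y r * B r ^+ 2 = A r.
    have [->|r0] := eqVneq r 0; first by rewrite (mchar0 _ hY) mul0r (mchar0 _ hA).
    by rewrite YE expr2 divfK // mulf_neq0 // mchar_neq0.
  over.
(* X = Y B phi and phi^2 = 1, so this factor cancels the X(1 - w)^-2 left by the Moebius
   substitution. *)
have -> : (Y (1 - z ^+ 2) * B (1 - z ^+ 2)) ^+ 2 = X (1 - z ^+ 2) ^+ 2.
  by rewrite XYC /C /cmul mulrA [RHS]exprMn [qphi _ ^+ 2]expr2 qphiK // mulr1 //.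
set S := \sum_r _.
have x0 : X (1 - z ^+ 2) != 0 by rewrite mchar_neq0.
have a0 := mcharN1_sqr _ hA.
rewrite /C /cmul -/C.
(* One factor A(-1) comes from the constant, the other from [gegenbauer_sumE]; their product is
   1. *)
transitivity (A (-1) ^+ 2 * (B (-1) * qphi (-1 : F) * Jacobi (@qphi F) C * S)).
  by rewrite a0; field.
by ring.
Qed.

End Transformation.
End Quadratic.
End Characters.

(** * Passage to the normalised functions through the values at 0 *)

Theorem mainTheorem8 (F : finFieldType) (A B : F -> algC) :
  (2%:R : F) != 0 ->
  mchar A -> mchar B ->
  B <> @eps F ->
  cmul (cmul B B) (cconj A) <> @eps F ->
  cmul (cmul A (cconj B)) (@qphi F) <> @eps F ->
  forall z : F, z <> 1 -> z <> -1 ->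
    F21 A B (cmul B B) (4%:R * z / (1 + z) ^+ 2)
    = cmul A A (1 + z) * F21 A (cmul (cmul A (@qphi F)) (cconj B)) (cmul B (@qphi F)) (z ^+ 2).
Proof.
move=> ch hA hB neB neY neX z z1 zN1.
have z1' : 1 + z != 0 by rewrite addrC addr_eq0; apply/eqP.
have w1 : z ^+ 2 != 1 by rewrite sqrf_eq1; apply/norP; split; apply/eqP.
have {neX} neX : cmul (cmul A (@qphi F)) (cconj B) <> @eps F.
  move=> e; apply: neX; rewrite -e; apply: functional_extensionality => x.
  by rewrite /cmul mulrAC.
have {neY} neY : cmul A (cconj (cmul B B)) <> @eps F.
  move=> e; apply: neY; apply: functional_extensionality => x.
  have := congr1 (fun f => (f x)^*) e; rewrite /cmul /cconj /eps /= rmorphM /= conjCK mulrC => ->.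
  by case: ifP; rewrite ?conjC0 ?conjC1.
set C := cmul B (@qphi F); set X := cmul _ (cconj B).
have four0 : (4 : F) != 0 by rewrite (natrM _ 2 2) mulf_neq0.
have hC : mchar C by apply: mchar_cmul => //; exact: mchar_qphi.
have N1 : (-1 : F) != 0 by rewrite oppr_eq0 oner_eq0.
have c0 := sum_mchar_neq_card _ _ hC.
have hH0 := Jacobi_P21_0 _ ch _ _ hA hB neX neY.
have hG0 := Jacobi_gegenbauer_0 _ ch _ _ hA hB neB.
have hH := P21_gegenbauer_proportional _ ch _ _ hA hB neB neX neY z w1.
have w0 : (0 : F) ^+ 2 != 1 by rewrite expr0n /= eq_sym oner_eq0.
have hH' := P21_gegenbauer_proportional _ ch _ _ hA hB neB neX neY 0 w0.
rewrite -/C -/X in hH0 hG0 hH hH'.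
rewrite expr0n /= in hH'.
have /norP[J0 P0] : ~~ ((Jacobi (cmul A (cconj (cmul B B))) C == 0) || (P21 A X C 0 == 0)).
  by rewrite -mulf_eq0 hH0 mulf_neq0 // mchar_neq0.
have /norP[K0 G0] : ~~ ((Jacobi (@qphi F) C == 0) || (gegenbauer_sum F A B 0 == 0)).
  by rewrite -mulf_eq0 hG0 mulf_neq0 // mchar_neq0 //; exact: mchar_qphi.
rewrite /F21 !(Jacobi_P21 _ A) //.
rewrite P21_gegenbauer //.
(* At z = 0 the argument 4z/(1+z)^2 is 0 and A(1+z)^2 is 1, so the same identity yields the
   left-hand normaliser. *)
have := P21_gegenbauer _ ch A B 0 hA hB.
rewrite mulr0 mul0r addr0 oner_eq0 (mchar1 _ _ hA) expr1n => -> //.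
have b0 := mchar_neq0 _ _ _ hB four0.
rewrite /cmul -expr2.
have -> : P21 A X C (z ^+ 2) / P21 A X C 0 = gegenbauer_sum F A B z / gegenbauer_sum F A B 0.
  (* The constant of proportionality is the same at [z] and at 0, so it drops out of the ratio. *)
  apply: (mulfI J0); rewrite mulrA hH; apply: (mulIf P0); rewrite divfK //.
  by rewrite [RHS]mulrAC hH'; field; exact: G0.
by field; rewrite b0 G0.
Qed.
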